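(* For arbitrary closure spaces $A,B$, the pure tensor insertion $\otimes:A\times B\to A\otimes B$, $(x,y)\mapsto x\otimes y$, is universal among all separately continuous maps from $A\times B$ to complete lattices: a map $f$ from $A\times B$ to a complete lattice $C$ is separately continuous if and only if there is a unique join-preserving map $f^{\vee}:A\otimes B\to C$ with $f(x,y)=f^{\vee}(x\otimes y)$ for all $(x,y)$. This map is given by $f^{\vee}(T)=\bigvee f[T]$.
   Context: A closure space $A$ is a set $\mathcal{U}A$ with a collection of subsets (''closed sets'') closed under arbitrary intersections (including $\bigcap\emptyset=\mathcal{U}A$). $\overline{X}$ is the least closed set containing $X$. A map between closure spaces is continuous if preimages of closed sets are closed. A complete lattice is regarded as a closure space whose closed sets are its principal ideals. A map $f:\mathcal{U}A\times\mathcal{U}B\to\mathcal{U}C$ is separately continuous if all maps ${}_xf:B\to C$, $y\mapsto f(x,y)$ and $f_y:A\to C$, $x\mapsto f(x,y)$ are continuous. $A\otimes B$ is the set, ordered by inclusion, of all tensors, i.e. $T\subseteq\mathcal{U}A\times\mathcal{U}B$ such that each $\{y:(x,y)\in T\}$ ($x\in\mathcal{U}A$) is closed in $B$ and each $\{x:(x,y)\in T\}$ ($y\in\mathcal{U}B$) is closed in $A$; it is closed under arbitrary intersections, hence a complete lattice. For $(x,y)\in\mathcal{U}A\times\mathcal{U}B$, $x\otimes y$ is the least tensor containing $(x,y)$. Join-preserving means preserving arbitrary joins (including the empty one). *)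

(* Defs.v *)
From HB Require Import structures.
From mathcomp Require Import all_boot all_order.
From mathcomp Require Import boolp classical_sets.

Set Implicit Arguments.
Unset Strict Implicit.
Unset Printing Implicit Defensive.

Import Order.TTheory.
Local Open Scope classical_set_scope.

(* Taking [F = set0] shows that the whole space is closed. *)
HB.mixin Record isClosureSpace (T : Type) := {
  cl_closed : set T -> Prop;
  cl_closed_bigcap : forall F : set (set T),
    (forall X, F X -> cl_closed X) -> cl_closed (\bigcap_(X in F) X)
}.

#[short(type="closureSpaceType")]
HB.structure Definition ClosureSpace := { T of isClosureSpace T }.

Definition cl_continuous (A B : closureSpaceType) (f : A -> B) : Prop :=
  forall X : set B, cl_closed X -> cl_closed (f @^-1` X).

Definition separately_continuous (A B C : closureSpaceType)
    (f : A * B -> C) : Prop :=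
  (forall x, cl_continuous (fun y => f (x, y))) /\
  (forall y, cl_continuous (fun x => f (x, y))).

HB.mixin Record isCompleteLattice d (T : Type) of Order.POrder d T := {
  bigjoin : set T -> T;
  bigjoinP : forall S : set T, supremums S (bigjoin S)
}.

#[short(type="completeLatticeType")]
HB.structure Definition CompleteLattice d :=
  { T of Order.POrder d T & isCompleteLattice d T }.

Definition join_preserving d d' (L : completeLatticeType d)
    (M : completeLatticeType d') (g : L -> M) : Prop :=
  forall S : set L, g (bigjoin S) = bigjoin (g @` S).

Definition principal_ideal d (L : porderType d) (a : L) : set L :=
  [set z | (z <= a)%O].

(* An alias of the carrier, so that viewing a complete lattice as a closure
   space can be inferred without clashing with other instances. *)
Definition ideal_space d (L : completeLatticeType d) : Type := L.

Lemma principal_ideal_bigcap d (L : completeLatticeType d) (F : set (set L)) :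
  (forall X, F X -> exists a, X = principal_ideal a) ->
  exists a, \bigcap_(X in F) X = principal_ideal a.
Proof.
move=> Fp; exists (bigjoin (\bigcap_(X in F) X)).
have [ub lb] := bigjoinP (\bigcap_(X in F) X).
apply/seteqP; split=> z; first exact: ub.
move=> /= zj X FX; have [a Xa] := Fp _ FX.
rewrite Xa; apply: le_trans zj _; apply: lb => t /(_ _ FX).
by rewrite Xa.
Qed.

HB.instance Definition _ d (L : completeLatticeType d) :=
  isClosureSpace.Build (ideal_space L) (@principal_ideal_bigcap d L).

Section TensorProduct.
Variables A B : closureSpaceType.
Implicit Types T : set (A * B).

Definition is_tensor T : Prop :=
  (forall x, cl_closed (xsection T x)) /\ (forall y, cl_closed (ysection T y)).

Lemma is_tensor_bigcap (F : set (set (A * B))) :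
  (forall T, F T -> is_tensor T) -> is_tensor (\bigcap_(T in F) T).
Proof.
move=> Ft; split=> z.
- have -> : xsection (\bigcap_(T in F) T) z =
            \bigcap_(X in [set xsection T z | T in F]) X.
    rewrite bigcap_image /xsection; apply/seteqP; split=> t /=.
      by move=> /set_mem tF T FT; apply/mem_set; exact: tF.
    by move=> tF; apply/mem_set => T FT; exact/set_mem/tF.
  by apply: cl_closed_bigcap => _ [T FT <-]; apply: (Ft T FT).1.
- have -> : ysection (\bigcap_(T in F) T) z =
            \bigcap_(X in [set ysection T z | T in F]) X.
    rewrite bigcap_image /ysection; apply/seteqP; split=> t /=.
      by move=> /set_mem tF T FT; apply/mem_set; exact: tF.
    by move=> tF; apply/mem_set => T FT; exact/set_mem/tF.
  by apply: cl_closed_bigcap => _ [T FT <-]; apply: (Ft T FT).2.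
Qed.

Lemma is_tensor_smallest (G : set (A * B)) : is_tensor (smallest is_tensor G).
Proof. by apply: is_tensor_bigcap => T []. Qed.

Record tensor_product : Type := Tensor {
  tensor_set :> set (A * B);
  _ : `[< is_tensor tensor_set >]
}.

HB.instance Definition _ := [isSub for tensor_set].
HB.instance Definition _ := [Choice of tensor_product by <:].
(* The order induced from [set (A * B)] is inclusion, see [subsetEset]. *)
HB.instance Definition _ :=
  [SubChoice_isSubPOrder of tensor_product by <: with set_display].

Definition tensor_gen (G : set (A * B)) : tensor_product :=
  Tensor (asboolT (is_tensor_smallest G)).

Definition tensor_join (S : set tensor_product) : tensor_product :=
  tensor_gen (\bigcup_(T in S) (T : set (A * B))).

Lemma tensor_joinP (S : set tensor_product) : supremums S (tensor_join S).
Proof.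
split=> [T ST|U Uub].
  rewrite -Order.le_val; apply/subsetPset => p Tp.
  by apply: sub_gen_smallest; exists T.
rewrite -Order.le_val; apply/subsetPset.
apply: smallest_sub; first exact/asboolP/(valP U).
by move=> p [T /Uub]; rewrite -Order.le_val => /subsetPset; apply.
Qed.

HB.instance Definition _ :=
  isCompleteLattice.Build set_display tensor_product tensor_joinP.

Definition pure_tensor (p : A * B) : tensor_product := tensor_gen [set p].

End TensorProduct.

(* Main.v *)
Require Import Defs.
From mathcomp Require Import all_boot all_order.
From mathcomp Require Import boolp classical_sets.

Set Implicit Arguments.
Unset Strict Implicit.
Unset Printing Implicit Defensive.

Import Order.POrderTheory.

(** The closed sets of a complete lattice C are its principal ideals, so a map
    f : A * B -> C is separately continuous exactly when every preimage
    f^-1(down c) is a tensor ([separately_continuousP]).  For such f, inclusion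
    of a tensor T in f^-1(down c) means that the join of f[T] is at most c: the
    map T |-> bigjoin (f @` T) is a left adjoint, with right adjoint
    c |-> f^-1(down c), and left adjoints preserve joins
    ([join_preserving_bigjoin_image]).  Moreover x (x) y is the least tensor
    through (x, y), so it lies below T exactly when (x, y) belongs to T
    ([pure_tensor_le]).  This has three consequences.  The insertion of pure
    tensors is separately continuous, since the preimage of the ideal of T is T.
    Every tensor is the join of the pure tensors of its members
    ([tensor_bigjoin_pure]), so a join-preserving map is determined, by the
    stated formula, by its values on pure tensors.  And a map that factors
    through the insertion by a join-preserving map is separately continuous,
    because join-preserving maps are continuous
    ([join_preserving_continuous]). *)

Local Open Scope classical_set_scope.

Lemma bigjoin_le d (L : completeLatticeType d) (S : set L) (a : L) :
  (bigjoin S <= a)%O <-> (forall s, S s -> (s <= a)%O).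
Proof.
have [ub lb] := bigjoinP S; split=> [Sa s Ss|]; last exact: lb.
by apply: le_trans Sa; apply: ub.
Qed.

Lemma le_ext d (L : porderType d) (a b : L) :
  (forall c, (a <= c)%O <-> (b <= c)%O) -> a = b.
Proof.
move=> ab; apply/le_anti/andP; split.
- exact/(ab b).
- exact/(ab a).
Qed.

Lemma tensor_le (A B : closureSpaceType) (T U : tensor_product A B) :
  (T <= U)%O <-> (T : set (A * B)) `<=` U.
Proof. by rewrite -Order.le_val; split=> /subsetPset. Qed.

Lemma tensorP (A B : closureSpaceType) (T : tensor_product A B) :
  is_tensor (T : set (A * B)).
Proof. exact/asboolP/(valP T). Qed.

Lemma pure_tensor_le (A B : closureSpaceType) (p : A * B)
    (T : tensor_product A B) :
  (pure_tensor p <= T)%O <-> (T : set (A * B)) p.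
Proof.
split=> [/tensor_le|Tp]; first by apply; apply: sub_gen_smallest.
apply/tensor_le; apply: smallest_sub; first exact: tensorP.
by move=> _ ->.
Qed.

Lemma tensor_bigjoin_pure (A B : closureSpaceType) (T : tensor_product A B) :
  T = bigjoin ((@pure_tensor A B) @` T).
Proof.
apply: le_ext => U; rewrite bigjoin_le tensor_le; split.
- by move=> TU _ [p Tp <-]; apply/pure_tensor_le/TU.
- by move=> TU p Tp; apply/pure_tensor_le/TU; exists p.
Qed.

(** The sections of f^-1(down c) are the preimages of the ideal of c under the
    two families of partial maps of f. *)
Lemma separately_continuousP (A B : closureSpaceType) d
    (C : completeLatticeType d) (f : A * B -> C) :
  separately_continuous (f : A * B -> ideal_space C) <->
  (forall c, is_tensor (f @^-1` principal_ideal c)).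
Proof.
have xE (c : C) x : xsection (f @^-1` principal_ideal c) x =
    (fun y => f (x, y)) @^-1` principal_ideal c.
  by apply/seteqP; split=> y; rewrite /xsection /= ?inE.
have yE (c : C) y : ysection (f @^-1` principal_ideal c) y =
    (fun x => f (x, y)) @^-1` principal_ideal c.
  by apply/seteqP; split=> x; rewrite /ysection /= ?inE.
split=> [[fx fy] c|fT].
- by split=> z; rewrite ?xE ?yE; [apply: fx|apply: fy]; exists c.
- split=> z _ [c ->].
  + by have := (fT c).1 z; rewrite xE.
  + by have := (fT c).2 z; rewrite yE.
Qed.

Lemma pure_tensor_separately_continuous (A B : closureSpaceType) :
  separately_continuous
    (@pure_tensor A B : A * B -> ideal_space (tensor_product A B)).
Proof.
apply/separately_continuousP => T.
have -> : (@pure_tensor A B) @^-1` principal_ideal T = T.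
  by apply/seteqP; split=> p /pure_tensor_le.
exact: tensorP.
Qed.

(** As f^-1(down c) is a tensor, it contains the join of a family of tensors as
    soon as it contains each of them. *)
Lemma join_preserving_bigjoin_image (A B : closureSpaceType) d
    (C : completeLatticeType d) (f : A * B -> C) :
  separately_continuous (f : A * B -> ideal_space C) ->
  join_preserving (fun T : tensor_product A B => bigjoin (f @` T)).
Proof.
move=> /separately_continuousP fT S; apply: le_ext => c.
pose P : tensor_product A B := Tensor (asboolT (fT c)).
have adj (T : tensor_product A B) : (bigjoin (f @` T) <= c)%O <-> (T <= P)%O.
  rewrite bigjoin_le tensor_le; split=> [Tc p Tp|TP _ [p Tp <-]].
  - by apply: Tc; exists p.
  - exact: TP.
rewrite adj !bigjoin_le; split=> [SP _ [T ST <-]|Sc T ST].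
- exact/adj/SP.
- by apply/adj/Sc; exists T.
Qed.

Lemma join_preserving_homo d d' (L : completeLatticeType d)
    (M : completeLatticeType d') (g : L -> M) (a b : L) :
  join_preserving g -> (a <= b)%O -> (g a <= g b)%O.
Proof.
move=> gj ab.
have -> : b = bigjoin [set x | (x <= b)%O].
  apply: le_ext => c; rewrite bigjoin_le.
  by split=> [bc x xb|]; [apply: le_trans xb bc|apply => /=].
rewrite gj; have [ub _] := bigjoinP (g @` [set x | (x <= b)%O]).
by apply: ub; exists a.
Qed.

(** The preimage of the ideal of c is the ideal of the join of all x with
    g x <= c, that is, of the value at c of the right adjoint of g. *)
Lemma join_preserving_continuous d d' (L : completeLatticeType d)
    (M : completeLatticeType d') (g : L -> M) :
  join_preserving g -> cl_continuous (g : ideal_space L -> ideal_space M).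
Proof.
move=> gj _ [c ->]; exists (bigjoin [set x | (g x <= c)%O]).
apply/seteqP; split=> x /= gx.
- have [ub _] := bigjoinP [set x : L | (g x <= c)%O].
  exact: ub.
- apply: le_trans (join_preserving_homo gj gx) _.
  by rewrite gj bigjoin_le => _ [y yc <-].
Qed.

Lemma join_preserving_tensorE (A B : closureSpaceType) d
    (C : completeLatticeType d) (f : A * B -> C) (g : tensor_product A B -> C) :
  join_preserving g -> (forall x y, f (x, y) = g (pure_tensor (x, y))) ->
  forall T : tensor_product A B, g T = bigjoin (f @` T).
Proof.
move=> gj fg T; have -> : f = g \o @pure_tensor A B by apply/funext => -[x y].
by rewrite -image_comp -gj -tensor_bigjoin_pure.
Qed.

Theorem theorem3p1 (A B : closureSpaceType) :
  separately_continuous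
    (@pure_tensor A B : A * B -> ideal_space (tensor_product A B)) /\
  forall (d : Order.disp_t) (C : completeLatticeType d) (f : A * B -> C),
    (separately_continuous (f : A * B -> ideal_space C) <->
     exists! g : tensor_product A B -> C,
       join_preserving g /\ forall x y, f (x, y) = g (pure_tensor (x, y))) /\
    (forall g : tensor_product A B -> C,
       join_preserving g ->
       (forall x y, f (x, y) = g (pure_tensor (x, y))) ->
       forall T : tensor_product A B, g T = bigjoin (f @` T)).
Proof.
split; first exact: pure_tensor_separately_continuous.
move=> d C f; split; last exact: join_preserving_tensorE.
split=> [fc|[g [[gj fg] _]]].
- exists (fun T : tensor_product A B => bigjoin (f @` T)); split; last first.
    move=> g [gj fg]; apply/funext => T.
    by rewrite (join_preserving_tensorE gj fg).
  split; first exact: join_preserving_bigjoin_image.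
  move=> x y; apply: le_ext => c; rewrite bigjoin_le.
  split=> [fxyc _ [p xyp <-]|]; last first.
    by apply; exists (x, y) => //; apply/pure_tensor_le.
  (* f^-1(down c) is a tensor through (x, y), so it contains x (x) y. *)
  have /separately_continuousP/(_ c) fT := fc.
  by apply: (smallest_sub fT _ xyp) => _ ->.
- have -> : f = g \o @pure_tensor A B.
    by apply/funext => -[x y].
  have [px py] := pure_tensor_separately_continuous A B.
  split=> z X /(join_preserving_continuous gj) Xc; [exact: px Xc|exact: py Xc].
Qed.
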